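(* Let $n\ge2$, $m\ge1$, let $R$ be a dominant region of the $m$-Shi arrangement with $m$-minimal alcove $\mathcal A$, and let $\lambda$ be the $n$-core with $\Phi(\lambda)=\mathcal A$. Then $H_{\theta,m}$ is a separating wall for $R$ if and only if $h^\lambda_{11}=n(m-1)+1$, where $h^\lambda_{11}$ is the hook length of the box $(1,1)$ of $\lambda$.
   Context: Let $e_1,\dots,e_n$ be the standard basis of $\mathbb R^n$ with the standard inner product $\langle\cdot,\cdot\rangle$, and $V=\{(a_1,\dots,a_n)\in\mathbb R^n:\sum_i a_i=0\}$. For $1\le i\le j\le n-1$ let $\alpha_{ij}=e_i-e_{j+1}$, $\alpha_i=\alpha_{ii}$, $\Delta^+=\{\alpha_{ij}\}$, $\theta=\alpha_{1,n-1}$. For $\alpha\in\Delta^+$, $k\in\mathbb Z$, let $H_{\alpha,k}=\{v\in V:\langle v,\alpha\rangle=k\}$. The $m$-Shi arrangement is $\{H_{\alpha,k}:\alpha\in\Delta^+,\,-m<k\le m\}$; its regions are the connected components of the complement of the union of its hyperplanes, and a region is dominant if it lies in $\{v\in V:\langle v,\alpha_i\rangle\ge0\ \forall i\}$. Alcoves are the connected components of $V\setminus\bigcup_{\alpha\in\Delta^+,k\in\mathbb Z}H_{\alpha,k}$; the fundamental alcove $A_0$ is the interior of $\{v\in V:\langle v,\theta\rangle\le1,\ \langle v,\alpha_i\rangle\ge0\ \forall i\}$. Each region contains a unique alcove separated from $A_0$ by the fewest hyperplanes $H_{\alpha,k}$ ($k\in\mathbb Z$), its $m$-minimal alcove. A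 wall of a region $R$ is a hyperplane of the $m$-Shi arrangement supporting a facet of $R$; it is a separating wall if $R$ and $A_0$ lie in different closed half-spaces determined by it. The affine symmetric group $\widehat{\mathfrak S}_n$ is the Coxeter group generated by $s_0,\dots,s_{n-1}$ (with $s_i^2=1$, $s_is_j=s_js_i$ if $i\not\equiv j\pm1\bmod n$, $s_is_js_i=s_js_is_j$ if $i\equiv j\pm1\bmod n$, for $n>2$; free product of two order-2 groups for $n=2$); $\mathfrak S_n=\langle s_1,\dots,s_{n-1}\rangle$. It acts freely and transitively on alcoves via its action on $V$: $s_i$ swaps coordinates $i,i+1$ ($i\ne0$) and $s_0(a_1,\dots,a_n)=(a_n+1,a_2,\dots,a_{n-1},a_1-1)$. It acts on $n$-cores (partitions with no hook length divisible by $n$): a box $(i,j)$ has residue $j-i\bmod n$; $s_r\lambda$ adds all addable boxes of residue $r$ if any exist, otherwise removes all removable boxes of residue $r$ if any exist, otherwise fixes $\lambda$. The map $\Phi$ sends $w\emptyset$ to $w^{-1}A_0$, where $w$ is of minimal length in its coset $w\mathfrak S_n$; $\Phi$ is a bijection from $n$-cores onto dominant alcoves. *)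

(* Defs.v *)
From HB Require Import structures.
From mathcomp Require Import all_boot all_order all_algebra.
From mathcomp Require Import perm.
From mathcomp Require Import boolp classical_sets cardinality reals.
From mathcomp Require Import topology normedtype.

Set Implicit Arguments.
Unset Strict Implicit.
Unset Printing Implicit Defensive.

Import Order.TTheory GRing.Theory Num.Theory.
Import numFieldNormedType.Exports.

Local Open Scope classical_set_scope.
Local Open Scope card_scope.
Local Open Scope ring_scope.

(** * Roots and hyperplanes *)

Definition dot (R : realType) (n : nat) (u v : 'rV[R]_n) : R :=
  \sum_i u ord0 i * v ord0 i.

(* Indices of basis vectors and roots are 1-based: [basis_vec R n k] is e_k for
   1 <= k <= n. *)
Definition basis_vec (R : realType) (n k : nat) : 'rV[R]_n :=
  \row_(j < n) (j.+1 == k)%:R.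

Definition V (R : realType) (n : nat) : set 'rV[R]_n :=
  [set v | \sum_i v ord0 i = 0].

Definition alpha (R : realType) (n i j : nat) : 'rV[R]_n :=
  basis_vec R n i - basis_vec R n j.+1.

Definition simple_root (R : realType) (n i : nat) : 'rV[R]_n := alpha R n i i.

Definition theta (R : realType) (n : nat) : 'rV[R]_n := alpha R n 1 n.-1.

Definition pos_roots (R : realType) (n : nat) : set 'rV[R]_n :=
  [set a | exists i j : nat,
     [/\ (1 <= i)%N, (i <= j)%N, (j <= n.-1)%N & a = alpha R n i j]].

Definition hyperplane (R : realType) (n : nat) (a : 'rV[R]_n) (k : int) :
    set 'rV[R]_n :=
  [set v | V v /\ dot v a = k%:~R].

Definition ge_halfspace (R : realType) (n : nat) (a : 'rV[R]_n) (k : int) :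
    set 'rV[R]_n :=
  [set v | V v /\ k%:~R <= dot v a].

Definition le_halfspace (R : realType) (n : nat) (a : 'rV[R]_n) (k : int) :
    set 'rV[R]_n :=
  [set v | V v /\ dot v a <= k%:~R].

Definition in_different_halfspaces (R : realType) (n : nat)
    (a : 'rV[R]_n) (k : int) (X Y : set 'rV[R]_n) : Prop :=
  (X `<=` ge_halfspace a k /\ Y `<=` le_halfspace a k) \/
  (X `<=` le_halfspace a k /\ Y `<=` ge_halfspace a k).

(** * Regions and alcoves *)

Definition affine_arrangement (R : realType) (n : nat) :
    set (set 'rV[R]_n) :=
  [set H | exists a k, pos_roots a /\ H = hyperplane a k].

Definition shi_arrangement (R : realType) (n m : nat) :
    set (set 'rV[R]_n) :=
  [set H | exists a (k : int),
     [/\ pos_roots a, - m%:Z < k <= m%:Z & H = hyperplane a k]].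

Definition complement (R : realType) (n : nat) (Arr : set (set 'rV[R]_n)) :
    set 'rV[R]_n :=
  @V R n `\` \bigcup_(H in Arr) H.

Definition components (T : topologicalType) (X : set T) : set (set T) :=
  [set C | exists2 x, X x & C = connected_component X x].

Definition shi_region (R : realType) (n m : nat) (Reg : set 'rV[R]_n) : Prop :=
  components (complement (@shi_arrangement R n m)) Reg.

Definition alcove (R : realType) (n : nat) (A : set 'rV[R]_n) : Prop :=
  components (complement (@affine_arrangement R n)) A.

Definition dominant_chamber (R : realType) (n : nat) : set 'rV[R]_n :=
  [set v | V v /\
     forall i : nat, (1 <= i <= n.-1)%N -> 0 <= dot v (simple_root R n i)].

Definition dominant (R : realType) (n : nat) (X : set 'rV[R]_n) : Prop :=
  X `<=` @dominant_chamber R n.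

(* Interior of X as a subset of V: V has empty interior in 'rV[R]_n. *)
Definition interior_in_V (R : realType) (n : nat) (X : set 'rV[R]_n) :
    set 'rV[R]_n :=
  [set v | V v /\ within (@V R n) (nbhs v) X].

Definition fundamental_alcove (R : realType) (n : nat) : set 'rV[R]_n :=
  interior_in_V
    [set v | dominant_chamber v /\ dot v (theta R n) <= 1].

Definition separating_hyperplanes (R : realType) (n : nat)
    (A B : set 'rV[R]_n) : set (set 'rV[R]_n) :=
  [set H | exists a k,
     [/\ pos_roots a, H = hyperplane a k & in_different_halfspaces a k A B]].

(* Only finitely many hyperplanes separate two alcoves, so comparing
   cardinalities with [#<=] compares their numbers. *)
Definition minimal_alcove (R : realType) (n : nat) (Reg A : set 'rV[R]_n) :
    Prop :=
  [/\ alcove A, A `<=` Reg &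
      forall B, alcove B -> B `<=` Reg ->
        separating_hyperplanes A (@fundamental_alcove R n) #<=
        separating_hyperplanes B (@fundamental_alcove R n)].

(** * Walls *)

Definition affine_hull (R : realType) (n : nat) (X : set 'rV[R]_n) :
    set 'rV[R]_n :=
  [set v | exists (k : nat) (p : 'I_k -> 'rV[R]_n) (c : 'I_k -> R),
     [/\ forall i, X (p i), \sum_i c i = 1 & v = \sum_i c i *: p i]].

(* The face of the closed polyhedron [closure Reg] cut out by a supporting
   hyperplane H is [closure Reg `&` H]; it is a facet, i.e. has the dimension
   of H, iff it affinely spans H. *)
Definition supports_facet (R : realType) (n : nat) (Reg : set 'rV[R]_n)
    (a : 'rV[R]_n) (k : int) : Prop :=
  (Reg `<=` ge_halfspace a k \/ Reg `<=` le_halfspace a k) /\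
  affine_hull (closure Reg `&` hyperplane a k) = hyperplane a k.

Definition wall (R : realType) (n m : nat) (Reg : set 'rV[R]_n)
    (a : 'rV[R]_n) (k : int) : Prop :=
  @shi_arrangement R n m (hyperplane a k) /\ supports_facet Reg a k.

Definition separating_wall (R : realType) (n m : nat) (Reg : set 'rV[R]_n)
    (a : 'rV[R]_n) (k : int) : Prop :=
  wall m Reg a k /\
  in_different_halfspaces a k Reg (@fundamental_alcove R n).

(** * The affine symmetric group *)

(* A word [:: i1; ...; ik] stands for s_{i1} ... s_{ik}. The affine symmetric
   group is the monoid of words modulo the congruence [cox_eq]; the inverse of
   the class of w is the class of [rev w]. *)
Definition cox_adj (n : nat) (i j : 'I_n) : bool :=
  (i == j.+1 %[mod n])%N || (j == i.+1 %[mod n])%N.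

Inductive cox_eq (n : nat) : seq 'I_n -> seq 'I_n -> Prop :=
| cox_refl w : cox_eq w w
| cox_sym u w : cox_eq u w -> cox_eq w u
| cox_trans u v w : cox_eq u v -> cox_eq v w -> cox_eq u w
| cox_cat u u' w w' : cox_eq u u' -> cox_eq w w' -> cox_eq (u ++ w) (u' ++ w')
| cox_invol i : cox_eq [:: i; i] [::]
| cox_comm i j : (2 < n)%N -> ~~ cox_adj i j -> cox_eq [:: i; j] [:: j; i]
| cox_braid i j : (2 < n)%N -> cox_adj i j ->
    cox_eq [:: i; j; i] [:: j; i; j].

Lemma cox_length_subproof (n : nat) (w : seq 'I_n) :
  exists l : nat, `[< exists2 u, cox_eq u w & size u = l >].
Proof. by exists (size w); apply/asboolP; exists w => //; exact: cox_refl. Qed.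

Definition cox_length (n : nat) (w : seq 'I_n) : nat :=
  ex_minn (cox_length_subproof w).

Definition min_coset_rep (n : nat) (w : seq 'I_n) : Prop :=
  forall v : seq 'I_n, all (fun i : 'I_n => (i != 0 :> nat)%N) v ->
    (cox_length w <= cox_length (w ++ v))%N.

(* Coordinates are 0-based here, so for i <> 0 the generator s_i exchanges
   positions i-1 and i; for i = 0, [ord_pred i] is the last position n-1. *)
Definition gen_act (R : realType) (n : nat) (i : 'I_n) (v : 'rV[R]_n) :
    'rV[R]_n :=
  if (i == 0 :> nat)%N then
    \row_j (if j == i then v ord0 (ord_pred i) + 1
            else if j == ord_pred i then v ord0 i - 1
            else v ord0 j)
  else \row_j v ord0 (tperm (ord_pred i) i j).

Definition word_act (R : realType) (n : nat) (w : seq 'I_n) (v : 'rV[R]_n) :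
    'rV[R]_n :=
  foldr (@gen_act R n) v w.

(** * Partitions and cores *)

Definition is_partition (la : seq nat) : bool :=
  sorted geq la && all (fun p => 0 < p)%N la.

Definition in_diagram (la : seq nat) (i j : nat) : bool :=
  (j < nth 0 la i)%N.

Definition arm (la : seq nat) (i j : nat) : nat := (nth 0 la i - j.+1)%N.

Definition leg (la : seq nat) (i j : nat) : nat :=
  (count (fun p => j < p)%N la - i.+1)%N.

(* Boxes are 0-based. The value 0 outside the diagram is a convention, which is
   only met at the corner box of the empty partition. *)
Definition hook_length (la : seq nat) (i j : nat) : nat :=
  if in_diagram la i j then (arm la i j + leg la i j).+1 else 0%N.

Definition is_core (n : nat) (la : seq nat) : Prop :=
  is_partition la /\
  forall i j, in_diagram la i j -> ~~ (n %| hook_length la i j)%N.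

Definition has_residue (n r i j : nat) : bool :=
  (j%:Z - i%:Z == r%:Z %[mod n%:Z])%Z.

(* At most one box can be added to (removed from) a given row i, namely the box
   in column [nth 0 la i] (resp. [(nth 0 la i).-1]). *)
Definition addable (n r : nat) (la : seq nat) (i : nat) : bool :=
  is_partition (incr_nth la i) && has_residue n r i (nth 0%N la i).

Definition removable (n r : nat) (la : seq nat) (i : nat) : bool :=
  [&& (i < size la)%N, sorted geq (set_nth 0%N la i (nth 0%N la i).-1)
    & has_residue n r i (nth 0%N la i).-1].

Definition strip0 (s : seq nat) : seq nat := [seq p <- s | (0 < p)%N].

(* When no box is removable either, the last branch returns la itself. *)
Definition core_gen_act (n : nat) (r : 'I_n) (la : seq nat) : seq nat :=
  if has (addable n r la) (iota 0 (size la).+1) then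
    strip0 [seq (nth 0 la i + addable n r la i)%N | i <- iota 0 (size la).+1]
  else
    strip0 [seq (nth 0 la i - removable n r la i)%N | i <- iota 0 (size la)].

Definition core_act (n : nat) (w : seq 'I_n) (la : seq nat) : seq nat :=
  foldr (@core_gen_act n) la w.

(* The graph of the bijection from n-cores to dominant alcoves. *)
Definition Phi (R : realType) (n : nat) (la : seq nat) (A : set 'rV[R]_n) :
    Prop :=
  exists w : seq 'I_n,
    [/\ min_coset_rep w, la = core_act w [::]
      & A = [set word_act (rev w) v | v in @fundamental_alcove R n]].

(* Main.v *)
Require Import Defs.
From mathcomp Require Import all_boot all_order all_algebra.
From mathcomp Require Import perm.
From mathcomp Require Import boolp classical_sets cardinality reals.
From mathcomp Require Import topology normedtype.
From mathcomp Require Import zify ring lra.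

Set Implicit Arguments.
Unset Strict Implicit.
Unset Printing Implicit Defensive.

Import Order.TTheory GRing.Theory Num.Theory.
Import numFieldNormedType.Exports.

Local Open Scope classical_set_scope.
Local Open Scope ring_scope.

(** Let w act on the integers as an affine permutation W. The beta-set of the
    core w.empty is W(Z_{<=0}), and the centre p of the alcove w^-1 A_0 has
    coordinates c - W(j) / n. Dominance makes W increasing on [1, n], so that
    h_11 = W(n) - n - W(1), and the hook condition becomes
    W(n) - W(1) = m n + 1, i.e. <p, theta> = m + 1/n.

    If it holds, p is so close to H_{theta,m} that a whole neighbourhood, in
    H_{theta,m}, of the projection of p lies in the closure of the region.
    Conversely, if H_{theta,m} is a separating wall but <p, theta> > m + 1/n
    and n >= 3, then some index 1 < i < n and some 0 <= l <= m satisfy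
    <p, e_1 - e_i> >= l and <p, e_i - e_n> >= m - l. Both bounds are Shi
    conditions, so they hold on the region, and the facet is squeezed into
    {<v, e_1 - e_i> = l}, which does not contain H_{theta,m}. For n = 2 the
    minimality of the alcove gives the result by counting hyperplanes. *)

(** * Affine permutations of the integers *)

(** The simple reflection s_r as an affine permutation: it exchanges r + t n and r + 1 + t n for
    every integer t. *)
Definition aff_gen (n r : nat) (x : int) : int :=
  if (n%:Z %| x - r%:Z)%Z then x + 1
  else if (n%:Z %| x - r%:Z - 1)%Z then x - 1 else x.

Definition aff_act (n : nat) (w : seq 'I_n) (x : int) : int :=
  foldr (fun i : 'I_n => aff_gen n i) x w.

Lemma aff_genD (n r : nat) (x t : int) :
  aff_gen n r (x + t * n%:Z) = aff_gen n r x + t * n%:Z.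
Proof.
rewrite /aff_gen.
have E (y : int) : (n%:Z %| y + t * n%:Z)%Z = (n%:Z %| y)%Z.
  by rewrite rpredDr // dvdz_mull.
have -> : x + t * n%:Z - r%:Z = x - r%:Z + t * n%:Z by ring.
have -> : x - r%:Z + t * n%:Z - 1 = x - r%:Z - 1 + t * n%:Z by ring.
by rewrite !E; case: ifP => _; [|case: ifP => _]; ring.
Qed.

Lemma aff_actD (n : nat) (w : seq 'I_n) (x t : int) :
  aff_act w (x + t * n%:Z) = aff_act w x + t * n%:Z.
Proof. by elim: w => //= i w IH; rewrite -aff_genD -IH. Qed.

Lemma dvdz_succ (n : nat) (x : int) :
  (2 <= n)%N -> (n%:Z %| x)%Z -> (n%:Z %| x + 1)%Z = false.
Proof.
move=> hn dx; rewrite rpredDl // dvdz1; apply/negbTE; lia.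
Qed.

Lemma aff_genK (n r : nat) : (2 <= n)%N -> involutive (aff_gen n r).
Proof.
move=> hn x; rewrite {2}/aff_gen; case: ifP => h1; [|case: ifP => h2].
- rewrite /aff_gen.
  have -> : x + 1 - r%:Z = x - r%:Z + 1 by ring.
  by rewrite dvdz_succ // addrK h1 addrK.
- rewrite /aff_gen.
  have -> : x - 1 - r%:Z = x - r%:Z - 1 by ring.
  by rewrite h2 subrK.
- by rewrite /aff_gen h1 h2.
Qed.

Lemma aff_act_cat (n : nat) (u w : seq 'I_n) (x : int) :
  aff_act (u ++ w) x = aff_act u (aff_act w x).
Proof. by rewrite /aff_act foldr_cat. Qed.

Lemma aff_actK (n : nat) (w : seq 'I_n) :
  (2 <= n)%N -> cancel (aff_act w) (aff_act (rev w)).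
Proof.
move=> hn; elim: w => //= i w IH x.
by rewrite rev_cons -cats1 aff_act_cat /= aff_genK // IH.
Qed.

Lemma aff_actVK (n : nat) (w : seq 'I_n) :
  (2 <= n)%N -> cancel (aff_act (rev w)) (aff_act w).
Proof. by move=> hn x; rewrite -{1}(revK w) aff_actK. Qed.

Lemma aff_act_mono (n : nat) (w : seq 'I_n) :
  (forall i : nat, (1 <= i < n)%N -> aff_act w i%:Z <= aff_act w i.+1%:Z) ->
  forall i j : nat, (1 <= i <= j)%N -> (j <= n)%N ->
    aff_act w i%:Z <= aff_act w j%:Z.
Proof.
move=> incr i; elim=> [|j IH] hij hj; first by lia.
case: (eqVneq i j.+1) => [->//|ne].
have h1 : aff_act w i%:Z <= aff_act w j%:Z by apply: IH; lia.
by apply: (le_trans h1); apply: incr; lia.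
Qed.

Lemma int_split (n : nat) (y : int) : (2 <= n)%N ->
  exists i : nat, exists2 t : int, (1 <= i <= n)%N & y = i%:Z + t * n%:Z.
Proof.
move=> hn; exists `|((y - 1) %% n%:Z)%Z|.+1; exists ((y - 1) %/ n%:Z)%Z.
  by have := @ltz_pmod (y - 1) n%:Z; have := @modz_ge0 (y - 1) n%:Z; lia.
have := divz_eq (y - 1) n%:Z; have := @modz_ge0 (y - 1) n%:Z.
set q := (_ %/ _)%Z; set e := (_ %% _)%Z => e0 ey.
have {}e0 : 0 <= e by apply: e0; lia.
by rewrite -[y](subrK 1) ey; move: (q * n%:Z) => z; lia.
Qed.

Lemma dvdz_small (n : nat) (x : int) :
  (n%:Z %| x)%Z -> - n%:Z < x < n%:Z -> x = 0.
Proof.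
move=> /dvdzP[t ->] h.
have t0 : t = 0 by apply/eqP; rewrite eq_le; apply/andP; split; nia.
by rewrite t0 mul0r.
Qed.

(** W is a bijection commuting with translation by n, so a congruence modulo n between values pulls
    back to the arguments, which are distinct points of one window. *)
Lemma aff_act_ndvd (n : nat) (w : seq 'I_n) (a b : 'I_n) : (2 <= n)%N ->
  a != b -> ~~ (n%:Z %| aff_act w b.+1%:Z - aff_act w a.+1%:Z)%Z.
Proof.
move=> hn ab; apply/negP => /dvdzP[t e].
have : b.+1%:Z = a.+1%:Z + t * n%:Z.
  apply: (can_inj (aff_actK w hn)); rewrite aff_actD -e; lia.
move=> e2; case/negP: ab; rewrite -val_eqE /=.
have : b%:Z - a%:Z = 0.
  apply: (@dvdz_small n); last by have := ltn_ord a; have := ltn_ord b; lia.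
  by apply/dvdzP; exists t; lia.
lia.
Qed.

(** * Beta-sets of partitions *)

Lemma is_partitionP (la : seq nat) :
  reflect ((forall i, nth 0 la i.+1 <= nth 0 la i)%N /\
           (forall i, i < size la -> 0 < nth 0 la i)%N)
          (is_partition la).
Proof.
apply: (iffP andP) => [[/(sortedP 0%N) sl /(all_nthP 0%N) pl]|[sl pl]].
  split=> // i; case: (ltnP i.+1 (size la)) => hi; first exact: sl.
  by rewrite nth_default.
split; first by apply/(sortedP 0%N) => i _; exact: sl.
exact/(all_nthP 0%N).
Qed.

Lemma partition_nth_anti (la : seq nat) (i j : nat) :
  is_partition la -> (i <= j)%N -> (nth 0 la j <= nth 0 la i)%N.
Proof.
move=> /is_partitionP[sl _]; elim: j => [|j IH]; first by rewrite leqn0 => /eqP->.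
rewrite leq_eqVlt => /orP[/eqP->//|]; rewrite ltnS => /IH h.
exact: leq_trans (sl j) h.
Qed.

Lemma partition_gt0 (la : seq nat) (i : nat) :
  is_partition la -> (0 < nth 0 la i)%N = (i < size la)%N.
Proof.
move=> /is_partitionP[_ pl]; case: (ltnP i (size la)) => hi; first exact: pl.
by rewrite nth_default.
Qed.

(* The beta-set of a partition, normalised so that the empty partition gives
   the nonpositive integers. *)
Definition bead (la : seq nat) (x : int) : Prop :=
  exists i : nat, x = (nth 0%N la i)%:Z - i%:Z.

(** The beads decrease strictly with the row, so only the bead of row i - 1 can occupy the site just
    above that of row i. *)
Lemma bead_gap_above (la : seq nat) (i : nat) : is_partition la ->
  ~ bead la ((nth 0%N la i)%:Z - i%:Z + 1) <->
  (i == 0 \/ nth 0 la i < nth 0 la i.-1)%N.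
Proof.
move=> pla; have anti := fun i j => @partition_nth_anti la i j pla.
split=> [h|h [k ek]].
  case: i h => [|i] h; first by left.
  right=> /=; rewrite ltnNge; apply/negP => h2; apply: h; exists i.
  by have := anti i i.+1 (leqnSn _); lia.
have hki : (k < i)%N.
  by rewrite ltnNge; apply/negP => hik; have := anti _ _ hik; lia.
by have := anti k i.-1; lia.
Qed.

Lemma bead_gap_below (la : seq nat) (i : nat) : is_partition la ->
  ~ bead la ((nth 0%N la i)%:Z - i%:Z - 1) <->
  (nth 0 la i.+1 < nth 0 la i)%N.
Proof.
move=> pla; have anti := fun i j => @partition_nth_anti la i j pla.
split=> [h|h [k ek]].
  rewrite ltnNge; apply/negP => h2; apply: h; exists i.+1.
  by have := anti i i.+1 (leqnSn _); lia.
have hki : (i < k)%N.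
  by rewrite ltnNge; apply/negP => hik; have := anti _ _ hik; lia.
by have := anti i.+1 k; lia.
Qed.

(** Adding a box moves the bead of its row up by one, and the residue of the new box is the old
    position of the bead. *)
Lemma addableP (n r : nat) (la : seq nat) (i : nat) : is_partition la ->
  addable n r la i <->
  ~ bead la ((nth 0%N la i)%:Z - i%:Z + 1) /\
  (n%:Z %| (nth 0%N la i)%:Z - i%:Z - r%:Z)%Z.
Proof.
move=> pla; rewrite bead_gap_above //.
rewrite /addable /has_residue eqz_mod_dvd.
suff E : is_partition (incr_nth la i) <-> (i == 0 \/ nth 0 la i < nth 0 la i.-1)%N.
  by split=> [/andP[/E ? ?]//|[/E ? ?]]; apply/andP.
case/is_partitionP: (pla) => sl pl; split.
- move/is_partitionP => [sl' _]; case: i sl' => [|i] sl'; first by left.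
  by right; have := sl' i; rewrite !nth_incr_nth /=; lia.
- move=> h; apply/is_partitionP; split=> j; rewrite ?size_incr_nth !nth_incr_nth.
    have := sl j; case: (eqVneq i j.+1) h => [->|_] /= h; lia.
  case: (ltnP i (size la)) => hi hj; first by have := pl j hj; lia.
  case: eqP => //= hij.
  have := @partition_nth_anti la j i.-1 pla; lia.
Qed.

(** Removing a box moves the bead down by one, and the residue of the box is the new position of the
    bead, hence the extra - 1. *)
Lemma removableP (n r : nat) (la : seq nat) (i : nat) : is_partition la ->
  removable n r la i <->
  ~ bead la ((nth 0%N la i)%:Z - i%:Z - 1) /\
  (n%:Z %| (nth 0%N la i)%:Z - i%:Z - r%:Z - 1)%Z.
Proof.
move=> pla; rewrite bead_gap_below //.
rewrite /removable /has_residue eqz_mod_dvd -(partition_gt0 i pla).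
case/is_partitionP: (pla) => sl pl.
have E0 : (0 < nth 0 la i)%N ->
  (nth 0%N la i).-1%:Z - i%:Z - r%:Z = (nth 0%N la i)%:Z - i%:Z - r%:Z - 1 by lia.
suff E : (0 < nth 0 la i)%N -> sorted geq (set_nth 0%N la i (nth 0%N la i).-1)
   <-> (nth 0 la i.+1 < nth 0 la i)%N.
  split=> [/and3P[h1 /(E h1) h2 h3]|[h1 h2]].
    by rewrite -E0.
  have h3 : (0 < nth 0 la i)%N by lia.
  by apply/and3P; split=> //; [exact/(E h3)|rewrite E0].
move=> hi; have hs : (i < size la)%N by rewrite -(partition_gt0 i pla).
split.
- move/(sortedP 0%N) => /(_ i); rewrite size_set_nth !nth_set_nth /= eqxx.
  rewrite (_ : i.+1 == i = false); last by lia.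
  have := partition_gt0 i.+1 pla; have := sl i.
  by lia.
- move=> h; apply/(sortedP 0%N) => j _; rewrite !nth_set_nth /=.
  have := sl j; case: (eqVneq j i) h => [->|_] h; case: eqP => e;
    rewrite /geq /= ?e; lia.
Qed.

(** The zeros of a weakly decreasing sequence come last, so deleting them shifts no other entry. *)
Lemma strip0_partition (g : nat -> nat) (N : nat) :
  (forall i, g i.+1 <= g i)%N -> (forall i, N <= i -> g i = 0)%N ->
  is_partition (strip0 [seq g i | i <- iota 0 N]) /\
  forall i, nth 0%N (strip0 [seq g i | i <- iota 0 N]) i = g i.
Proof.
elim: N g => [|N IH] g anti g0.
  by split=> //= i; rewrite nth_nil g0.
have -> : [seq g i | i <- iota 0 N.+1] =
    g 0%N :: [seq g i.+1 | i <- iota 0 N].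
  rewrite /= -[1%N]addn0 iotaDl -map_comp; congr cons.
have [p1 p2] := IH (fun i => g i.+1) (fun i => anti i.+1)
                   (fun i h => g0 i.+1 h).
rewrite /strip0 /=; case: ifP => hg; last first.
  have gz i : g i = 0%N.
    by elim: i => [|i IHi]; [lia|have := anti i; lia].
  by split=> [|i]; [exact: p1|rewrite p2 !gz].
have q i : nth 0%N (g 0%N :: strip0 [seq g i.+1 | i <- iota 0 N]) i = g i.
  by case: i => //= i; rewrite p2.
split=> //; apply/is_partitionP; split=> i; rewrite !q //.
by case: i => //= i; rewrite ltnS -(partition_gt0 i p1) p2.
Qed.

Lemma bead_le_opp_size (la : seq nat) (x : int) :
  x <= - (size la)%:Z -> bead la x.
Proof. by move=> h; exists `|x|%N; rewrite nth_default; lia. Qed.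

Lemma bead_le_head (la : seq nat) (x : int) :
  is_partition la -> bead la x -> x <= (nth 0%N la 0)%:Z.
Proof.
by move=> pla [i ->]; have := partition_nth_anti pla (leq0n i); lia.
Qed.

(** Nonempty rows have beads above [1 - size la], empty rows have beads below it. *)
Lemma bead_min_gap (la : seq nat) :
  is_partition la -> ~ bead la (1 - (size la)%:Z).
Proof. by move=> pla [i]; have := partition_gt0 i pla; lia. Qed.

(** * Flush bead sets and the action of the generators on cores *)

Lemma flush_mul (n : nat) (B : int -> Prop) :
  (forall x, B x -> B (x - n%:Z)) ->
  forall (x : int) (t : nat), B x -> B (x - t%:Z * n%:Z).
Proof.
move=> fl x; elim=> [|t IH] Bx; first by rewrite mul0r subr0.
have -> : x - t.+1%:Z * n%:Z = x - t%:Z * n%:Z - n%:Z by lia.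
exact/fl/IH.
Qed.

(* In a flush bead set, no residue class carries both an addable and a
   removable box. *)
Lemma flush_add_remove (n : nat) (B : int -> Prop) (x y : int) :
  (forall x, B x -> B (x - n%:Z)) -> B x -> ~ B (x + 1) -> B y ->
  (n%:Z %| y - 1 - x)%Z -> B (y - 1).
Proof.
(* According to the sign of t in y - 1 - x = t n, going down from y reaches x + 1, which is vacant,
   or going down from x reaches y - 1. *)
move=> fl Bx nBx By /dvdzP[[t|t] e].
  case: nBx; have -> : x + 1 = y - t%:Z * n%:Z by rewrite -e; ring.
  exact: flush_mul.
have -> : y - 1 = x - t.+1%:Z * n%:Z.
  by rewrite -[y - 1](subrK x) e NegzE; ring.
exact: flush_mul.
Qed.

(** s_r exchanges the sites congruent to r with those congruent to r + 1. If some box is addable,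
    flushness rules out a removable one, so the exchange only lifts the beads of addable rows;
    otherwise it only lowers those of removable rows. *)
Lemma core_gen_act_bead (n : nat) (r : 'I_n) (la : seq nat) : (2 <= n)%N ->
  is_partition la -> (forall x, bead la x -> bead la (x - n%:Z)) ->
  is_partition (core_gen_act r la) /\
  forall x, bead (core_gen_act r la) x <-> bead la (aff_gen n r x).
Proof.
move=> hn pla fl; have [sl pl] := is_partitionP _ pla.
have dsub (x y : int) : (n%:Z %| x)%Z -> (n%:Z %| y)%Z -> (n%:Z %| x - y)%Z.
  exact: rpredB.
rewrite /core_gen_act; case: ifP => [/hasP[i0 _ ai0]|/negbT/hasPn na].
- have [|i hi|pg ng] := @strip0_partition
    (fun i => nth 0 la i + addable n r la i)%N (size la).+1.
  + move=> i; have := sl i; case: (boolP (addable n r la i.+1)) => [|_]; last by lia.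
    move=> /(addableP _ _ _ pla)[/(bead_gap_above _ pla)] /=; lia.
  + rewrite nth_default ?(ltnW hi) //; case: (boolP (addable _ _ _ _)) => // /addableP.
    move=> /(_ pla)[/(bead_gap_above _ pla)]; rewrite !nth_default; lia.
  split=> // x.
  have [g0 d0] := (addableP _ _ _ pla).1 ai0.
  have B0 : bead la ((nth 0%N la i0)%:Z - i0%:Z) by exists i0.
  have nrem y : bead la y -> (n%:Z %| y - r%:Z - 1)%Z -> bead la (y - 1).
    move=> By dy; apply: (flush_add_remove fl B0 g0 By).
    by rewrite (_ : _ - _ = (y - r%:Z - 1) -
      ((nth 0%N la i0)%:Z - i0%:Z - r%:Z)); [exact: dsub|ring].
  split.
  + case=> i; rewrite ng; case: (boolP (addable n r la i)) => ai /= ->.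
      have [gi di] := (addableP _ _ _ pla).1 ai.
      exists i; rewrite /aff_gen (_ : _ - r%:Z =
        (nth 0%N la i)%:Z - i%:Z - r%:Z + 1); last by lia.
      by rewrite dvdz_succ // addrK di; lia.
    rewrite addn0 /aff_gen; case: ifP => h1; [|case: ifP => h2].
    * apply: contrapT => h; case/negP: ai; exact/addableP.
    * by apply: nrem => //; exists i.
    * by exists i.
  + rewrite /aff_gen; case: ifP => h1; [|case: ifP => h2].
    * move=> Bx1; have [i ei] : bead la x.
        rewrite -[x](addrK 1); apply: nrem => //.
        by rewrite (_ : _ - _ = x - r%:Z) //; ring.
      exists i; rewrite ng; case: (boolP (addable n r la i)) => [|_];
        last by rewrite addn0.
      by move=> /(addableP _ _ _ pla)[]; rewrite -ei.
    * case=> i ei; have dx : (n%:Z %| (nth 0%N la i)%:Z - i%:Z - r%:Z)%Z.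
        by rewrite -ei (_ : _ - _ = x - r%:Z - 1) //; ring.
      case: (boolP (addable n r la i)) => ai.
        by exists i; rewrite ng ai; lia.
      have [j ej] : bead la ((nth 0%N la i)%:Z - i%:Z + 1).
        by apply: contrapT => h; case/negP: ai; exact/addableP.
      exists j; rewrite ng; case: (boolP (addable n r la j)) => [|_];
        last by rewrite addn0; lia.
      move=> /(addableP _ _ _ pla)[_]; rewrite -ej.
      by rewrite (_ : _ - _ = (nth 0%N la i)%:Z - i%:Z - r%:Z + 1) ?dvdz_succ //; ring.
    * case=> i ei; exists i; rewrite ng; case: (boolP (addable n r la i)) => [|_];
        last by rewrite addn0.
      by move=> /(addableP _ _ _ pla)[_]; rewrite -ei h1.
- have nadd y : bead la y -> (n%:Z %| y - r%:Z)%Z -> bead la (y + 1).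
    case=> i -> dy; apply: contrapT => h.
    have ai : addable n r la i by apply/addableP.
    (* An addable row is row 0 or follows a nonempty row, so testing the rows up to [size la] finds
       them all. *)
    have : (i <= size la)%N.
      have /(bead_gap_above _ pla) := h; have := partition_gt0 i.-1 pla; lia.
    by move=> hi; have := na i; rewrite mem_iota ai => /(_ _)/negP; apply.
  have [i|i hi|pg ng] := @strip0_partition
    (fun i => nth 0 la i - removable n r la i)%N (size la).
  + have := sl i; case: (boolP (removable n r la i)) => [|_]; last by lia.
    move=> /(removableP _ _ _ pla)[/(bead_gap_below _ pla)] /=; lia.
  + by rewrite nth_default.
  have remgt i : removable n r la i -> (0 < nth 0 la i)%N.
    by move=> /(removableP _ _ _ pla)[/(bead_gap_below _ pla)]; lia.
  split=> // x.
  split.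
  + case=> i; rewrite ng; case: (boolP (removable n r la i)) => ai /= ->.
      have [gi di] := (removableP _ _ _ pla).1 ai; have := remgt i ai => gt.
      exists i; rewrite /aff_gen (_ : _ - r%:Z =
        (nth 0%N la i)%:Z - i%:Z - r%:Z - 1); last by lia.
      by rewrite di; lia.
    rewrite subn0 /aff_gen; case: ifP => h1; [|case: ifP => h2].
    * by apply: nadd => //; exists i.
    * apply: contrapT => h; case/negP: ai; exact/removableP.
    * by exists i.
  + rewrite /aff_gen; case: ifP => h1; [|case: ifP => h2].
    * case=> i ei; have dx : (n%:Z %| (nth 0%N la i)%:Z - i%:Z - r%:Z - 1)%Z.
        by rewrite -ei (_ : _ - _ = x - r%:Z) //; ring.
      case: (boolP (removable n r la i)) => ai.
        by exists i; rewrite ng ai; have := remgt i ai; lia.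
      have [j ej] : bead la ((nth 0%N la i)%:Z - i%:Z - 1).
        by apply: contrapT => h; case/negP: ai; exact/removableP.
      exists j; rewrite ng; case: (boolP (removable n r la j)) => [|_];
        last by rewrite subn0; lia.
      move=> /(removableP _ _ _ pla)[_]; rewrite -ej -ei => d2.
      have := dvdz_succ hn d2.
      by rewrite (_ : _ + 1 = x - r%:Z) ?h1 //; ring.
    * move=> Bx1; have [i ei] : bead la x.
        rewrite -[x](subrK 1); apply: nadd => //.
        by rewrite (_ : _ - _ = x - r%:Z - 1) //; ring.
      exists i; rewrite ng; case: (boolP (removable n r la i)) => [|_];
        last by rewrite subn0.
      by move=> /(removableP _ _ _ pla)[]; rewrite -ei.
    * case=> i ei; exists i; rewrite ng; case: (boolP (removable n r la i)) => [|_];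
        last by rewrite subn0.
      by move=> /(removableP _ _ _ pla)[_]; rewrite -ei h2.
Qed.

(** Flushness at each induction step comes from the description already obtained: the inverse of W
    commutes with translation by n, and nonpositive integers stay so after subtracting n. *)
Lemma core_act_bead (n : nat) (w : seq 'I_n) : (2 <= n)%N ->
  is_partition (core_act w [::]) /\
  forall x, bead (core_act w [::]) x <-> aff_act (rev w) x <= 0.
Proof.
move=> hn; elim: w => [|r w [IHp IHb]].
  split=> //= x; split=> [[i ->]|h]; first by rewrite nth_nil; lia.
  exact: bead_le_opp_size.
have [|? B] := core_gen_act_bead r hn IHp.
  move=> x /IHb h; apply/IHb; rewrite (_ : x - _ = x + (-1) * n%:Z); last by ring.
  by rewrite aff_actD; lia.
split=> // x; rewrite rev_cons -cats1 aff_act_cat /=.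
by rewrite B IHb.
Qed.

(** * The corner hook of a core in terms of the window *)

Lemma hook_length_corner (la : seq nat) : is_partition la ->
  hook_length la 0 0 = (nth 0 la 0 + size la).-1%N.
Proof.
move=> pla; rewrite /hook_length /in_diagram partition_gt0 // /arm /leg.
(* For the empty partition, the convention outside the diagram and the truncated predecessor both
   give 0. *)
case: ifP => h; last by case: la h {pla}.
have -> : count (fun p => 0 < p)%N la = size la.
  by apply/eqP; rewrite -all_count; case/andP: pla.
have := partition_gt0 0%N pla; lia.
Qed.

(** Since W increases on the window and commutes with translation by n, W(0) = W(n) - n is the
    largest bead, hence the first part, and W(1) is the smallest vacant site, which is 1 minus the
    number of parts. *)
Lemma core_hook_aff_act (n m : nat) (w : seq 'I_n) : (2 <= n)%N -> (1 <= m)%N ->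
  (forall i : nat, (1 <= i < n)%N -> aff_act w i%:Z <= aff_act w i.+1%:Z) ->
  hook_length (core_act w [::]) 0 0 = (n * (m - 1) + 1)%N <->
  aff_act w n%:Z - aff_act w 1 = (m * n).+1%:Z.
Proof.
move=> hn hm incr; have [] := core_act_bead w hn.
set la := core_act w [::] => pla B.
have mono := aff_act_mono incr; have split_int := fun y => @int_split n y hn.
have E0 : aff_act w 0 = aff_act w n%:Z - n%:Z.
  rewrite (_ : 0 = n%:Z + (-1) * n%:Z) ?aff_actD; first by ring.
  by ring.
have top : (nth 0%N la 0)%:Z = aff_act w n%:Z - n%:Z.
  apply/eqP; rewrite eq_le; apply/andP; split; last first.
    by apply: bead_le_head => //; rewrite -E0; apply/B; rewrite aff_actK.
  have /B : bead la (nth 0%N la 0)%:Z by exists 0%N; rewrite subr0.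
  have [i [t hi]] := split_int (aff_act (rev w) (nth 0%N la 0)%:Z) => e ley.
  have -> : (nth 0%N la 0)%:Z = aff_act w (i%:Z + t * n%:Z) by rewrite -e aff_actVK.
  rewrite aff_actD; have : aff_act w i%:Z <= aff_act w n%:Z by apply: mono; lia.
  move: ley; rewrite e => ley.
  have t1 : t + 1 <= 0 by rewrite leNgt; apply/negP => t0; nia.
  have tn : (t + 1) * n%:Z <= 0 by nia.
  by lia.
have bot : 1 - (size la)%:Z = aff_act w 1.
  apply/eqP; rewrite eq_le; apply/andP; split.
    rewrite leNgt; apply/negP => h.
    have /B : bead la (aff_act w 1) by apply: bead_le_opp_size; lia.
    by rewrite aff_actK.
  have /B := bead_min_gap pla.
  have [i [t hi]] := split_int (aff_act (rev w) (1 - (size la)%:Z)) => e ley.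
  have -> : 1 - (size la)%:Z = aff_act w (i%:Z + t * n%:Z) by rewrite -e aff_actVK.
  rewrite aff_actD; have : aff_act w 1 <= aff_act w i%:Z by apply: (mono 1%N); lia.
  move: ley; rewrite e => ley.
  have t1 : 0 <= t by rewrite leNgt; apply/negP => t0; nia.
  have tn : 0 <= t * n%:Z by nia.
  by lia.
rewrite hook_length_corner //.
(* For the empty core the predecessor truncates, but then the gap is n - 1 and the hook is 0, so
   neither equation holds. *)
by split; nia.
Qed.

(** * Regions *)

(** Root indices are 1-based and [alpha] shifts its second one, so [a.+1] and [b] address the
    0-based coordinates a and b. *)
Lemma dot_alpha (R : realType) (n : nat) (v : 'rV[R]_n) (a b : 'I_n) :
  dot v (alpha R n a.+1 b) = v ord0 a - v ord0 b.
Proof.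
have E (c : 'I_n) : \sum_j v ord0 j * (j.+1 == c.+1)%:R = v ord0 c.
  rewrite (bigD1 c) //= eqxx mulr1 big1 ?addr0 // => j /negbTE hj.
  by rewrite eqSS -val_eqE /= in hj *; rewrite hj mulr0.
rewrite -(E a) -(E b) -sumrB; apply: eq_bigr => j _.
by rewrite !mxE mulrBr.
Qed.

Lemma pos_rootsP (R : realType) (n : nat) (x : 'rV[R]_n) :
  pos_roots x <-> exists a b : 'I_n, (a < b)%N /\ x = alpha R n a.+1 b.
Proof.
split=> [[i [j [i1 ij jn ->]]]|[a [b [ab ->]]]].
  have hi : (i.-1 < n)%N by lia.
  have hj : (j < n)%N by lia.
  by exists (Ordinal hi), (Ordinal hj); split=> /=; rewrite ?prednK //; lia.
by exists a.+1, b; split=> //; have := ltn_ord b; lia.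
Qed.

Lemma nbhs_rowP (R : realType) (n : nat) (v : 'rV[R]_n) (P : set 'rV[R]_n) :
  nbhs v P <-> exists2 e : R, 0 < e &
    forall u : 'rV[R]_n, (forall j, `|u ord0 j - v ord0 j| < e) -> P u.
Proof.
rewrite nbhs_ballP; split=> [[e /= e0 h]|[e e0 h]]; exists e => // u hu.
  by apply: h; split=> // i j; rewrite ord1 /ball /= distrC.
by apply: h => j; case: hu => _ /(_ ord0 j); rewrite /ball /= distrC.
Qed.

Lemma root_continuous (R : realType) (n : nat) (a b : 'I_n) :
  continuous (fun v : 'rV[R]_n => v ord0 a - v ord0 b).
Proof.
by move=> v; exact: (cvgB (@coord_continuous R 1 n ord0 a v)
                          (@coord_continuous R 1 n ord0 b v)).
Qed.

(** * Sides of hyperplanes and connected components *)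

Section Complement.
Variables (R : realType) (n : nat) (Arr : set (set 'rV[R]_n)).

Lemma complement_avoid (a b : 'I_n) (k : int) (v : 'rV[R]_n) :
  Arr (hyperplane (alpha R n a.+1 b) k) -> complement Arr v ->
  v ord0 a - v ord0 b != k%:~R.
Proof.
move=> hA [Vv nv]; apply/eqP => e; apply: nv.
by exists (hyperplane (alpha R n a.+1 b) k) => //; split=> //; rewrite dot_alpha.
Qed.

(** A root maps the connected set C onto an interval, which misses k because C avoids the
    hyperplane. *)
Lemma component_side (C : set 'rV[R]_n) (a b : 'I_n) (k : int)
    (p v : 'rV[R]_n) :
  connected C -> C `<=` complement Arr ->
  Arr (hyperplane (alpha R n a.+1 b) k) -> C p -> C v ->
  (k%:~R < p ord0 a - p ord0 b) = (k%:~R < v ord0 a - v ord0 b).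
Proof.
move=> cC CA hA.
wlog h : p v / k%:~R < p ord0 a - p ord0 b.
  move=> W Cp Cv; apply/idP/idP => h; first by rewrite -(W p v).
  by rewrite -(W v p).
move=> Cp Cv; rewrite h; apply/esym; rewrite ltNge; apply/negP => h2.
have /connected_intervalP I := connected_continuous_connected cC
  (continuous_subspaceT (A := C) (@root_continuous R n a b)).
have [|||u Cu /eqP] := I (v ord0 a - v ord0 b) (p ord0 a - p ord0 b) _ _ k%:~R.
- by exists v.
- by exists p.
- by rewrite h2 ltW.
- exact/negP/(complement_avoid hA)/CA.
Qed.

(** The segment from p to v stays in the complement: on it, a root minus k is a convex combination
    of two numbers of the same strict sign. *)
Lemma component_segment (p v : 'rV[R]_n) :
  (forall H, Arr H -> exists (a b : 'I_n) k, H = hyperplane (alpha R n a.+1 b) k /\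
     (k%:~R < p ord0 a - p ord0 b /\ k%:~R < v ord0 a - v ord0 b \/
      p ord0 a - p ord0 b < k%:~R /\ v ord0 a - v ord0 b < k%:~R)) ->
  V p -> V v -> connected_component (complement Arr) p v.
Proof.
move=> side Vp Vv.
pose f (t : R) : 'rV[R]_n := p + t *: (v - p).
have cf : continuous f.
  move=> t; apply: cvgD; first exact: cvg_cst.
  by apply: cvgZr_tmp; exact: cvg_id.
pose S := f @` [set t : R | 0 <= t <= 1].
have cS : connected S.
  apply: connected_continuous_connected; last exact: continuous_subspaceT.
  apply/connected_intervalP => x y /= /andP[x0 x1] /andP[y0 y1] z /andP[xz zy].
  by rewrite (le_trans x0 xz) (le_trans zy y1).
have Sp : S p by exists 0; rewrite /= ?lexx ?ler01 // /f scale0r addr0.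
have Sv : S v by exists 1; rewrite /= ?lexx ?ler01 // /f scale1r addrC subrK.
apply: (connected_component_max Sp _ cS) => // _ [t /andP[t0 t1] <-]; split.
  rewrite /V /= /f; under eq_bigr do rewrite !mxE.
  by rewrite big_split /= -mulr_sumr sumrB Vv Vp subrr mulr0 addr0.
move=> [H /side[a [b [k [-> s]]]]] [_]; rewrite dot_alpha /f !mxE => e.
have {}e : (1 - t) * (p ord0 a - p ord0 b - k%:~R) +
           t * (v ord0 a - v ord0 b - k%:~R) = 0 by rewrite -e; ring.
move: s e; set x := p ord0 a - _; set y := v ord0 a - _; move: (k%:~R) => c s e.
have st : 0 < t \/ 0 < 1 - t by case: (ltP 0 t); [left|right; lra].
by case: s st => -[h1 h2] [h|h]; nra.
Qed.

End Complement.

Section Shi.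
Variables (R : realType) (n m : nat) (Reg : set 'rV[R]_n).
Hypothesis shiReg : shi_region m Reg.

Lemma shi_region_V (v : 'rV[R]_n) : Reg v -> V v.
Proof.
by case: shiReg => x _ -> /connected_component_sub [].
Qed.

Lemma shi_region_side (a b : 'I_n) (k : int) (p v : 'rV[R]_n) :
  (a < b)%N -> - m%:Z < k <= m%:Z -> Reg p -> Reg v ->
  (k%:~R < p ord0 a - p ord0 b) = (k%:~R < v ord0 a - v ord0 b).
Proof.
move=> ab hk; case: shiReg => x _ -> Rp Rv.
apply: (@component_side R n (@shi_arrangement R n m)
  (connected_component (complement (@shi_arrangement R n m)) x) a b k p v) => //.
- exact: component_connected.
- exact: connected_component_sub.
- by exists (alpha R n a.+1 b), k; split=> //; apply/pos_rootsP; exists a, b.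
Qed.

(** p lies on no Shi hyperplane, so for each of them one of the two premises holds. *)
Lemma shi_region_mem (p v : 'rV[R]_n) : Reg p -> V v ->
  (forall (a b : 'I_n) (k : int), (a < b)%N -> - m%:Z < k <= m%:Z ->
     (k%:~R < p ord0 a - p ord0 b -> k%:~R < v ord0 a - v ord0 b) /\
     (p ord0 a - p ord0 b < k%:~R -> v ord0 a - v ord0 b < k%:~R)) ->
  Reg v.
Proof.
move=> Rp Vv side; have Vp := shi_region_V Rp; move: Rp.
case: shiReg => x _ -> cp; rewrite (same_connected_component cp).
apply: component_segment => // H hA.
have [al [k [/pos_rootsP[a [b [ab ->]]] hk e]]] := hA.
exists a, b, k; split=> //; have [s1 s2] := side a b k ab hk.
have := @complement_avoid _ _ (@shi_arrangement R n m) a b k p.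
rewrite -e => /(_ hA (connected_component_sub cp)); rewrite neq_lt => /orP[h|h].
  by right; split=> //; exact: s2.
by left; split=> //; exact: s1.
Qed.

End Shi.

(** * Centres of alcoves *)

(* With the window of an affine permutation f extended by f (x + n) = f x + n,
   these are the images of the centre of the fundamental alcove. *)
Definition alcove_center (R : realType) (n : nat) (f : int -> int) : 'rV[R]_n :=
  \row_j (n.+1%:R / (2 * n%:R) - (f j.+1%:Z)%:~R / n%:R).

(** Swapping coordinates i and i + 1 swaps f(i) and f(i + 1). For s_0 the shifts by 1 turn f(n) into
    f(n) - n = f(0) and f(1) into f(1) + n = f(n + 1). *)
Lemma gen_act_center (R : realType) (n : nat) (i : 'I_n) (f : int -> int) :
  (2 <= n)%N -> (forall x t, f (x + t * n%:Z) = f x + t * n%:Z) ->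
  gen_act i (alcove_center R n f) = alcove_center R n (f \o aff_gen n i).
Proof.
move=> hn fD; have n0 : n%:R != 0 :> R by rewrite pnatr_eq0; lia.
have nd x : - n%:Z < x < n%:Z -> x != 0 -> (n%:Z %| x)%Z = false.
  by move=> h x0; apply/negP => /dvdz_small/(_ h)/eqP; apply/negP.
have ni := ltn_ord i.
have vp : nat_of_ord (ord_pred i) = if (i == 0 :> nat)%N then n.-1 else i.-1.
  rewrite /=; case: eqP => [->|i0]; first by rewrite add0n modn_small; lia.
  rewrite (_ : (i + n).-1 = i.-1 + n)%N; last by lia.
  by rewrite modnDr modn_small; lia.
rewrite /gen_act; case: (eqVneq (i : nat) 0%N) vp => i0 vp; apply/rowP => j;
  have nj := ltn_ord j; rewrite /comp !mxE.
- case: (eqVneq j i) => [ji|ji]; [|case: (eqVneq j (ord_pred i)) => [jp|jp]].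
  + have -> : aff_gen n i j.+1%:Z = 0.
      rewrite ji i0 /aff_gen nd //; last by lia.
      by rewrite (_ : 1%:Z - 0%:Z - 1 = 0 :> int) ?dvdz0.
    have -> : f 0 = f n%:Z - n%:Z.
      by rewrite -[X in f X](addrN n%:Z) -[X in _ - X]mul1r -mulNr fD mulNr mul1r.
    rewrite vp prednK; last by lia.
    by rewrite rmorphB /=; field.
  + have -> : aff_gen n i j.+1%:Z = n%:Z + 1.
      rewrite i0 jp vp prednK; last by lia.
      by rewrite /aff_gen subr0 dvdzz.
    have -> : f (n%:Z + 1) = f 1 + n%:Z.
      by rewrite addrC -[X in 1 + X]mul1r fD mul1r.
    by rewrite i0 rmorphD /=; field.
  + have ij : (j : nat) != 0%N.
      by apply: contraNneq ji => e; apply/eqP/val_inj; rewrite /= e i0.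
    have pj : (j : nat) != n.-1.
      by apply: contraNneq jp => e; apply/eqP/val_inj; rewrite /= e -vp.
    by rewrite ?mxE /aff_gen i0 !nd //; lia.
- case: tpermP => [->|->|/eqP jp /eqP ji].
  + rewrite vp /aff_gen prednK; last by lia.
    rewrite subrr dvdz0 (_ : i%:Z + 1 = i.+1%:Z) //; lia.
  + rewrite vp /aff_gen nd //; [|by lia|by lia].
    rewrite (_ : _ - _ - 1 = 0 :> int); last by lia.
    rewrite dvdz0 prednK; last by lia.
    by rewrite (_ : i.+1%:Z - 1 = i%:Z) //; lia.
  + have ij : (j : nat) != i by [].
    have pj : (j : nat) != i.-1.
      by apply: contraNneq jp => e; apply/eqP/val_inj; rewrite /= e -vp.
    by rewrite /aff_gen !nd //; lia.
Qed.

(** Generators compose with f on the right, so the reversed word, which represents the inverse of w,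
    produces W in the original order. *)
Lemma word_act_center (R : realType) (n : nat) (w : seq 'I_n) (f : int -> int) :
  (2 <= n)%N -> (forall x t, f (x + t * n%:Z) = f x + t * n%:Z) ->
  word_act (rev w) (alcove_center R n f) = alcove_center R n (f \o aff_act w).
Proof.
move=> hn; elim: w f => [|i w IH] f fD //=.
rewrite rev_cons -cats1 /word_act foldr_cat /= gen_act_center // -/(word_act _ _).
rewrite IH // => x t /=; by rewrite aff_genD fD.
Qed.

Lemma alcove_center_diff (R : realType) (n : nat) (f : int -> int) (a b : 'I_n) :
  alcove_center R n f ord0 a - alcove_center R n f ord0 b =
  (f b.+1%:Z - f a.+1%:Z)%:~R / n%:R.
Proof. by rewrite !mxE rmorphB /=; ring. Qed.

(** The constant (n + 1) / (2 n) is the mean of j / n over 1 <= j <= n. *)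
Lemma alcove_center_V (R : realType) (n : nat) : (1 <= n)%N ->
  V (alcove_center R n id).
Proof.
move=> hn; rewrite /V /=; under eq_bigr do rewrite mxE.
have n0 : n%:R != 0 :> R by rewrite pnatr_eq0; lia.
rewrite sumrB sumr_const card_ord -mulr_suml.
have -> : \sum_(i < n) (i.+1%:Z)%:~R = (n * n.+1)%:R / 2 :> R.
  elim: (n) => [|k IH]; first by rewrite big_ord0 mul0n mul0r.
  rewrite big_ord_recr /= IH -[k.+1%:~R]/(k.+1%:R) !natrM -!natr1.
  by field.
by rewrite -mulr_natr natrM; field.
Qed.

Lemma fundamental_alcove_sub (R : realType) (n : nat) (v : 'rV[R]_n) :
  fundamental_alcove v -> dominant_chamber v /\ dot v (theta R n) <= 1.
Proof. by case=> Vv /nbhs_singleton; apply. Qed.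

Lemma simple_rootE (R : realType) (n i : nat) (v : 'rV[R]_n) :
  (1 <= i <= n.-1)%N -> exists a b : 'I_n,
    [/\ a.+1 = i, b = i :> nat & dot v (simple_root R n i) = v ord0 a - v ord0 b].
Proof.
move=> hi; have ha : (i.-1 < n)%N by lia.
have hb : (i < n)%N by lia.
exists (Ordinal ha), (Ordinal hb); split=> //=; first by lia.
by rewrite -dot_alpha /= prednK //; lia.
Qed.

Lemma alcove_center_fundamental (R : realType) (n : nat) : (2 <= n)%N ->
  fundamental_alcove (alcove_center R n id).
Proof.
move=> hn; have n0 : 0 < n%:R :> R by rewrite ltr0n; lia.
split; first by apply: alcove_center_V; lia.
(* At the centre the simple roots equal 1/n and theta equals 1 - 1/n; moving each coordinate by less
   than 1/(2n) changes a root by less than 1/n. *)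
apply/nbhs_rowP; exists (1 / (2 * n%:R)); first by rewrite divr_gt0 // mulr_gt0.
move=> u hu Vu.
have close (a b : 'I_n) : `|(u ord0 a - u ord0 b) - (b%:R - a%:R) / n%:R| < n%:R^-1.
  have := alcove_center_diff R id a b.
  rewrite (_ : b.+1%:Z - a.+1%:Z = b%:Z - a%:Z); last by lia.
  rewrite rmorphB /= -!pmulrn => <-.
  have := hu a; have := hu b; rewrite invfM.
  move: (n%:R^-1) => e; rewrite !ltr_norml => /andP[? ?] /andP[? ?].
  by apply/andP; split; lra.
have i0 : 0 < n%:R^-1 :> R by rewrite invr_gt0.
split; [split=> // i hi|].
  have [a [b [ea eb ->]]] := simple_rootE u hi.
  have ab : b%:R - a%:R = 1 :> R by rewrite eb -ea -natr1 addrAC subrr add0r.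
  have := close a b; rewrite ab mul1r.
  by rewrite ltr_norml => /andP[? _]; lra.
have h0 : (0 < n)%N by lia.
have hl : (n.-1 < n)%N by lia.
have := close (Ordinal h0) (Ordinal hl).
rewrite -dot_alpha /= -/(theta R n) subr0.
have -> : n.-1%:R / n%:R = 1 - n%:R^-1 :> R.
  by rewrite -subn1 natrB // mulrBl mul1r divff // lt0r_neq0.
by rewrite ltr_norml => /andP[_ ?]; lra.
Qed.

(** * Facets in the direction of the highest root *)

Lemma theta_alpha (R : realType) (n : nat) (lo hi : 'I_n) :
  lo = 0%N :> nat -> hi = n.-1 :> nat -> theta R n = alpha R n lo.+1 hi.
Proof. by move=> -> ->. Qed.

Lemma theta_coord (R : realType) (n : nat) (lo hi j : 'I_n) :
  lo = 0%N :> nat -> hi = n.-1 :> nat ->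
  theta R n ord0 j = (j == lo)%:R - (j == hi)%:R.
Proof.
by move=> elo ehi; rewrite (theta_alpha R elo ehi) !mxE !eqSS.
Qed.

Lemma sum_delta (R : realType) (n : nat) (a : 'I_n) :
  \sum_(j < n) (j == a)%:R = 1 :> R.
Proof.
by rewrite (bigD1 a) //= eqxx big1 ?addr0 // => j /negbTE ->.
Qed.

(** Roots take values in (1/n) Z at the centres, so a strict inequality against an integer has a
    margin of 1/n. *)
Lemma int_lt_div (R : realType) (n : nat) (k z : int) : (1 <= n)%N ->
  k%:~R < z%:~R / n%:R :> R -> k%:~R + n%:R^-1 <= z%:~R / n%:R :> R.
Proof.
move=> hn; have n0 : 0 < n%:R :> R by rewrite ltr0n.
rewrite ltr_pdivlMr // ler_pdivlMr // mulrDl mulVf ?lt0r_neq0 //.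
by rewrite pmulrn -rmorphM /= -[1]/(1%:~R) -rmorphD /= ltr_int ler_int; lia.
Qed.

Lemma div_lt_int (R : realType) (n : nat) (k z : int) : (1 <= n)%N ->
  z%:~R / n%:R < k%:~R :> R -> z%:~R / n%:R <= k%:~R - n%:R^-1 :> R.
Proof.
move=> hn h.
have := @int_lt_div R n (- k) (- z) hn; rewrite !rmorphN /= mulNr; lra.
Qed.

Lemma int_le_div (R : realType) (n : nat) (k z : int) : (1 <= n)%N ->
  (k%:~R <= z%:~R / n%:R :> R) = (k * n%:Z <= z).
Proof.
move=> hn; have n0 : 0 < n%:R :> R by rewrite ltr0n.
by rewrite ler_pdivlMr // pmulrn -rmorphM /= ler_int.
Qed.

Lemma closure_ge (R : realType) (n : nat) (X : set 'rV[R]_n) (a b : 'I_n)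
    (c : R) :
  (forall v, X v -> c <= v ord0 a - v ord0 b) ->
  forall v, closure X v -> c <= v ord0 a - v ord0 b.
Proof.
move=> hX v cv; rewrite leNgt; apply/negP => h.
pose e := (c - (v ord0 a - v ord0 b)) / 2.
have e0 : 0 < e by rewrite /e; lra.
have [u [Xu hu]] : X `&` [set u | forall j, `|u ord0 j - v ord0 j| < e] !=set0.
  by apply: cv; apply/nbhs_rowP; exists e.
have := hX u Xu; have := hu a; have := hu b; rewrite /e !ltr_norml.
by move=> /andP[? ?] /andP[? ?]; lra.
Qed.

Lemma exists_V (R : realType) (n : nat) (x : 'I_n -> R) : (1 <= n)%N ->
  exists2 v : 'rV[R]_n, V v &
    forall a b, v ord0 a - v ord0 b = x a - x b.
Proof.
move=> hn; exists (\row_j (x j - (\sum_i x i) / n%:R)); last first.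
  by move=> a b; rewrite !mxE; ring.
rewrite /V /=; under eq_bigr do rewrite mxE.
rewrite sumrB sumr_const card_ord -[X in _ - X]mulr_natr divfK ?subrr //.
by rewrite pnatr_eq0; lia.
Qed.

Lemma affine_hull_root (R : realType) (n : nat) (X : set 'rV[R]_n)
    (a b : 'I_n) (c : R) :
  (forall v, X v -> v ord0 a - v ord0 b = c) ->
  forall v, affine_hull X v -> v ord0 a - v ord0 b = c.
Proof.
move=> hX v [k [q [d [Xq sd ->]]]].
rewrite !summxE -sumrB -[RHS]mul1r -sd mulr_suml; apply: eq_bigr => i _.
by rewrite !mxE -mulrBr hX.
Qed.

(** This provides the index that squeezes the facet. If the gap D is at least (m + 1) n, then i = 2
    works by rounding; otherwise i is chosen by a congruence. *)
Lemma exists_middle (n m : nat) (w : seq 'I_n) : (3 <= n)%N ->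
  (forall i : nat, (1 <= i < n)%N -> aff_act w i%:Z <= aff_act w i.+1%:Z) ->
  (m * n).+1%:Z < aff_act w n%:Z - aff_act w 1 ->
  exists i l : nat, [/\ (1 < i < n)%N, (l <= m)%N,
    l%:Z * n%:Z <= aff_act w i%:Z - aff_act w 1 &
    (m - l)%:Z * n%:Z <= aff_act w n%:Z - aff_act w i%:Z].
Proof.
move=> hn incr; have mono := aff_act_mono incr.
have hn2 : (2 <= n)%N by lia.
set D := aff_act w n%:Z - aff_act w 1 => hD.
case: (leP ((m.+1 * n)%N%:Z) D) => hD2.
  have h1 : aff_act w 1 <= aff_act w 2%N%:Z by apply: (mono 1%N); lia.
  have h2 : aff_act w 2%N%:Z <= aff_act w n%:Z by apply: mono; lia.
  have : 0 <= aff_act w 2%N%:Z - aff_act w 1 by lia.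
  case eu : (aff_act w 2%N%:Z - aff_act w 1) => [u|//] _.
  have ez : aff_act w n%:Z - aff_act w 2%N%:Z = D - u%:Z by rewrite /D -eu; ring.
  (* Take l to be the smaller of m and u / n rounded down: the remainder is less than n, and D has n
     to spare over m n. *)
  case: (leqP (m * n) u) => hu.
    by exists 2%N, m; split; rewrite ?eu ?subnn //; lia.
  have := divn_eq u n; have := @ltn_pmod u n; set l := (u %/ n)%N; set r := (u %% n)%N.
  move=> hr er; have {}hr : (r < n)%N by apply: hr; lia.
  have lm : (l < m)%N by rewrite ltnNge; apply/negP => ml; nia.
  exists 2%N, l; split; rewrite ?ez ?eu; [lia|lia|lia|].
  by rewrite -subzn; [nia|lia].
(* Now m n + 1 < D < (m + 1) n. Take i in the window with W(i) congruent to W(1) + 1 modulo n; then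
   W(i) - W(1) = l n + 1 and W(n) - W(i) = D - 1 - l n >= (m - l) n. *)
have [i [t hi]] := @int_split n (aff_act (rev w) (aff_act w 1 + 1)) hn2.
move=> /(congr1 (aff_act w)); rewrite aff_actVK // aff_actD => ei.
have i1 : aff_act w 1 <= aff_act w i%:Z by apply: (mono 1%N); lia.
have i2 : aff_act w i%:Z <= aff_act w n%:Z by apply: mono; lia.
have eD : aff_act w n%:Z - aff_act w i%:Z = D - 1 + t * n%:Z by rewrite /D; lia.
have t0 : t <= 0 by rewrite leNgt; apply/negP => t0; nia.
have [l el] : exists l : nat, t = - l%:Z by exists `|t|%N; lia.
rewrite el in ei eD.
have lm : (l <= m)%N by rewrite leqNgt; apply/negP => ml; nia.
exists i, l; split=> //; [|by lia|by rewrite eD -subzn //; lia].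
(* i = 1 would give 1 = - l n, and i = n would give D = l n + 1 <= m n + 1. *)
apply/andP; split; rewrite ltnNge; apply/negP => h.
  have e1 : i = 1%N by lia.
  have : 1 = - l%:Z * n%:Z by apply: (addrI (aff_act w 1)); rewrite ei e1.
  by nia.
have e1 : i = n by lia.
have lmn : l%:Z * n%:Z <= m%:Z * n%:Z by nia.
by rewrite e1 in ei; rewrite /D in hD; lia.
Qed.

(** * The wall H_{theta,m} and the gap W(n) - W(1) *)

Section Wall.
Variables (R : realType) (n m : nat) (Reg : set 'rV[R]_n) (w : seq 'I_n).
Hypotheses (hn : (2 <= n)%N) (hm : (1 <= m)%N).
Hypothesis shiReg : shi_region m Reg.
Variables (lo hi : 'I_n).
Hypotheses (elo : lo = 0%N :> nat) (ehi : hi = n.-1 :> nat).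

Let p := alcove_center R n (aff_act w).
Hypothesis Rp : Reg p.

Let gap := aff_act w n%:Z - aff_act w 1.

Let n1 : (1 <= n)%N. Proof. by lia. Qed.
Let n0 : 0 < n%:R :> R. Proof. by rewrite ltr0n. Qed.
Let i0 : 0 < n%:R^-1 :> R. Proof. by rewrite invr_gt0. Qed.
Let lohi : (lo < hi)%N. Proof. by lia. Qed.

Lemma center_theta : p ord0 lo - p ord0 hi = gap%:~R / n%:R.
Proof. by rewrite alcove_center_diff elo ehi prednK. Qed.

(** p avoids the hyperplane, so the inequality at p is strict, and a strict Shi inequality holds
    throughout the region. *)
Lemma shi_region_ge (a b : 'I_n) (k : nat) (v : 'rV[R]_n) :
  (a < b)%N -> (k <= m)%N -> k%:R <= p ord0 a - p ord0 b -> Reg v ->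
  k%:R <= v ord0 a - v ord0 b.
Proof.
move=> ab km h Rv.
have hk : - m%:Z < k%:Z <= m%:Z by lia.
have := shi_region_side shiReg ab hk Rp Rv; rewrite -!pmulrn => E.
apply/ltW; rewrite -E lt_neqAle h andbT eq_sym.
apply: (@complement_avoid R n (@shi_arrangement R n m) a b k%:Z).
  by exists (alpha R n a.+1 b), k%:Z; split=> //; apply/pos_rootsP; exists a, b.
by move: Rp; case: shiReg => x _ -> /connected_component_sub.
Qed.

(* When gap = m n + 1, this is the projection of p to H_{theta,m}. *)
Let q := p - (n%:R^-1 / 2) *: theta R n.

(** From p to q a positive root other than theta moves by at most 1/(2n), and from q to v by less
    than 1/(4n). The total is below the margin 1/n of [int_lt_div], so it stays on its side of every
    integer. For theta the bound m suffices, m being the last Shi level. *)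
Lemma facet_box (v : 'rV[R]_n) : gap = (m * n).+1%:Z -> V v ->
  m%:R < v ord0 lo - v ord0 hi ->
  (forall j, `|v ord0 j - q ord0 j| < n%:R^-1 / 8) -> Reg v.
Proof.
move=> eg Vv hv close; apply: (shi_region_mem shiReg Rp) => // a b k ab hk.
have Eq j : q ord0 j = p ord0 j - n%:R^-1 / 2 * ((j == lo)%:R - (j == hi)%:R).
  by rewrite /q !mxE -(theta_coord R j elo ehi) !mxE.
have := close a; have := close b; rewrite !ltr_norml !Eq.
have -> : (a == hi) = false.
  by apply/negP => /eqP/(congr1 val) /= e; have := ltn_ord b; lia.
have -> : (b == lo) = false by apply/negP => /eqP/(congr1 val) /= e; lia.
case: (boolP ((a == lo) && (b == hi))) => [/andP[/eqP ea /eqP eb]|nab].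
  rewrite ea eb !eqxx center_theta eg /=.
  have E : (m * n).+1%:Z%:~R / n%:R = m%:R + n%:R^-1 :> R.
    by rewrite -pmulrn -natr1 natrM; field; rewrite lt0r_neq0.
  have ct := center_theta; rewrite eg E in ct.
  rewrite E => /andP[? ?] /andP[? ?].
  have i1 : n%:R^-1 <= 1 :> R by rewrite invf_le1 // ler1n.
  split=> h.
    apply: le_lt_trans hv; rewrite pmulrn ler_int leNgt; apply/negP => mk.
    have : (m%:Z + 1)%:~R <= k%:~R :> R by rewrite ler_int; lia.
    by rewrite rmorphD /= -pmulrn; lra.
  have mk : m%:Z < k.
    rewrite -(ltr_int R) -pmulrn; lra.
  by move: hk; lia.
have E : (a == lo)%:R + (b == hi)%:R <= 1 :> R.
  by move: nab; case: (a == lo); case: (b == hi) => //= _; rewrite ?addr0 ?add0r ?ler01.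
have E0 : 0 <= (a == lo)%:R + (b == hi)%:R :> R by rewrite addr_ge0 // ler0n.
move: E E0; set x := (a == lo)%:R; set y := (b == hi)%:R; clearbody x y => E E0.
rewrite [false%:R]mulr0n subr0 sub0r.
move=> /andP[c1 c2] /andP[c3 c4]; have pd := alcove_center_diff R (aff_act w) a b.
rewrite -/p in pd.
have i1 : n%:R^-1 * (x + y) <= n%:R^-1 by rewrite ger_pMr.
have i2 : 0 <= n%:R^-1 * (x + y) by rewrite mulr_ge0 // ltW.
split; rewrite pd => h.
  have := int_lt_div n1 h; rewrite -pd; lra.
have := div_lt_int n1 h; rewrite -pd; lra.
Qed.

(** Pushing y by a small d along theta raises theta above m and, as 1/16 + 1/16 = 1/8, stays in the
    box of [facet_box]. *)
Lemma facet_closure (y : 'rV[R]_n) : gap = (m * n).+1%:Z -> V y ->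
  y ord0 lo - y ord0 hi = m%:R ->
  (forall j, `|y ord0 j - q ord0 j| < n%:R^-1 / 16) -> closure Reg y.
Proof.
move=> eg Vy ey close B /nbhs_rowP[e e0 hB].
pose d := Num.min e (n%:R^-1 / 16) / 2.
have d0 : 0 < d by rewrite /d divr_gt0 // lt_min e0 divr_gt0.
have dm1 : Num.min e (n%:R^-1 / 16) <= e by rewrite ge_min lexx.
have dm2 : Num.min e (n%:R^-1 / 16) <= n%:R^-1 / 16 by rewrite ge_min lexx orbT.
have md : Num.min e (n%:R^-1 / 16) = d * 2 by rewrite /d divfK ?pnatr_eq0.
rewrite md in dm1 dm2.
have de : d < e by lra.
have dn : d < n%:R^-1 / 16 by lra.
have nlh : (lo == hi) = false by apply/negP => /eqP/(congr1 val) /= e2; lia.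
have nhl : (hi == lo) = false by rewrite eq_sym.
pose u := y + d *: theta R n.
have Eu j : u ord0 j = y ord0 j + d * ((j == lo)%:R - (j == hi)%:R).
  by rewrite /u !mxE -(theta_coord R j elo ehi) !mxE.
have dist j : `|u ord0 j - y ord0 j| <= d.
  rewrite Eu addrAC subrr add0r normrM (gtr0_norm d0) ger_pMr //.
  case: (eqVneq j lo) => [->|_]; first by rewrite nlh subr0 normr1.
  by case: (j == hi); rewrite sub0r normrN ?normr1 ?normr0 ?ler01.
exists u; split; last by apply: hB => j; exact: le_lt_trans (dist j) de.
apply: facet_box => //.
- rewrite /V /=; under eq_bigr do rewrite Eu.
  by rewrite big_split /= -mulr_sumr sumrB !sum_delta subrr mulr0 addr0.
- by rewrite !Eu !eqxx nlh nhl [true%:R]mulr1n [false%:R]mulr0n; lra.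
- move=> j; have := close j; have := dist j; rewrite ler_norml !ltr_norml.
  by move=> /andP[? ?] /andP[? ?]; apply/andP; split; lra.
Qed.

Lemma theta_separating_wall : gap = (m * n).+1%:Z ->
  separating_wall m Reg (theta R n) m%:Z.
Proof.
move=> eg.
have eth := theta_alpha R elo ehi.
have Vp := shi_region_V shiReg Rp.
have E : (m * n).+1%:Z%:~R / n%:R = m%:R + n%:R^-1 :> R.
  by rewrite -pmulrn -natr1 natrM; field; rewrite lt0r_neq0.
have ct := center_theta; rewrite eg E in ct.
have ge : Reg `<=` ge_halfspace (theta R n) m%:Z.
  move=> v Rv; split; first exact: (shi_region_V shiReg).
  rewrite eth dot_alpha -pmulrn; apply: shi_region_ge => //.
  by rewrite ct lerDl ltW.
have Eq j : q ord0 j = p ord0 j - n%:R^-1 / 2 * ((j == lo)%:R - (j == hi)%:R).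
  by rewrite /q !mxE -(theta_coord R j elo ehi) !mxE.
have nlh : (lo == hi) = false by apply/negP => /eqP/(congr1 val) /= e2; lia.
have nhl : (hi == lo) = false by rewrite eq_sym.
have Vq : V q.
  rewrite /V /=; under eq_bigr do rewrite Eq.
  by rewrite sumrB -mulr_sumr sumrB !sum_delta subrr mulr0 subr0.
have qt : q ord0 lo - q ord0 hi = m%:R.
  by rewrite !Eq !eqxx nlh nhl [true%:R]mulr1n [false%:R]mulr0n; lra.
split; last first.
  left; split=> // v /fundamental_alcove_sub[[Vv _] h]; split=> //.
  by apply: (le_trans h); rewrite -pmulrn ler1n.
split.
  exists (theta R n), m%:Z; split=> //; last by lia.
  by rewrite eth; apply/pos_rootsP; exists lo, hi.
split; first by left.
apply/seteqP; split=> y.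
  case=> k [x [c [hx sc ->]]]; split.
    rewrite /V /=; under eq_bigr do rewrite summxE.
    rewrite exchange_big big1 //= => i _; under eq_bigr do rewrite mxE.
    by rewrite -mulr_sumr; case: (hx i) => _ [-> _]; rewrite mulr0.
  rewrite eth dot_alpha.
  apply: (@affine_hull_root R n (closure Reg `&` hyperplane (theta R n) m%:Z)).
    by move=> v [_ [_]]; rewrite eth dot_alpha.
  by exists k, x, c.
case=> Vy; rewrite eth dot_alpha -pmulrn => ey.
(* M bounds the coordinates of y - q, and s scales y - q into the box of [facet_closure]; 1 + M
   keeps the denominator positive. *)
pose M := \sum_j `|y ord0 j - q ord0 j|.
have M0 : 0 <= M by apply: sumr_ge0.
have leM j : `|y ord0 j - q ord0 j| <= M.
  by rewrite /M (bigD1 j) //= lerDl; apply: sumr_ge0.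
pose s := n%:R^-1 / (16 * (1 + M)).
have s0 : 0 < s by rewrite /s divr_gt0 //; lra.
pose z := q + s *: (y - q).
have Ez j : z ord0 j = q ord0 j + s * (y ord0 j - q ord0 j) by rewrite !mxE.
have close j : `|z ord0 j - q ord0 j| < n%:R^-1 / 16.
  rewrite Ez addrAC subrr add0r normrM (gtr0_norm s0).
  have h : s * `|y ord0 j - q ord0 j| <= s * M by rewrite ler_pM2l.
  apply: (le_lt_trans h).
  have -> : n%:R^-1 / 16 = s * (1 + M) :> R.
    by rewrite /s; field; rewrite !lt0r_neq0 //; lra.
  by rewrite ltr_pM2l //; lra.
have Vz : V z.
  rewrite /V /=; under eq_bigr do rewrite Ez.
  by rewrite big_split /= -mulr_sumr sumrB Vy Vq subrr mulr0 addr0.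
have zt : z ord0 lo - z ord0 hi = m%:R by rewrite !Ez; nra.
have Hq : (closure Reg `&` hyperplane (alpha R n lo.+1 hi) m%:Z) q.
  split; last by split=> //; rewrite dot_alpha -pmulrn.
  by apply: facet_closure => // j; rewrite subrr normr0 divr_gt0.
have Hz : (closure Reg `&` hyperplane (alpha R n lo.+1 hi) m%:Z) z.
  split; last by split=> //; rewrite dot_alpha -pmulrn.
  exact: facet_closure.
(* Solving z = q + s (y - q) for y writes it as an affine combination of q and z, both in the
   face. *)
exists 2%N, (fun i : 'I_2 => if i == ord0 then q else z),
  (fun i : 'I_2 => if i == ord0 then 1 - s^-1 else s^-1); split.
- by move=> i; case: ifP.
- by rewrite !big_ord_recl big_ord0 /=; ring.
- rewrite !big_ord_recl big_ord0 /= /z addr0 (scalerDr s^-1 q) scalerA.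
  by rewrite mulVf ?lt0r_neq0 // scale1r scalerBl scale1r addrA subrK addrC subrK.
Qed.

(** At the centre of A_0 theta equals 1 - 1/n < m, which settles the side of the region. Then p
    gives m n <= gap, strictly because n divides no difference of two window values. *)
Lemma separating_wall_gap : separating_wall m Reg (theta R n) m%:Z ->
  (m * n)%N%:Z < gap.
Proof.
have eth := theta_alpha R elo ehi.
case=> _ [] [h1 h2].
  have [_] := h1 _ Rp; rewrite eth dot_alpha center_theta int_le_div // => h.
  rewrite lt_neqAle PoszM h andbT; apply/eqP => e.
  have : lo != hi by apply/eqP => /(congr1 val) /= e2; lia.
  move/(aff_act_ndvd w hn); rewrite ehi elo prednK // => /negP; apply.
  by apply/dvdzP; exists m%:Z; rewrite -/gap -e.
have /h2[_] := alcove_center_fundamental R hn.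
rewrite eth dot_alpha alcove_center_diff int_le_div // elo ehi prednK // => h.
by exfalso; nia.
Qed.

Lemma separating_wall_gap_eq : (3 <= n)%N ->
  (forall i : nat, (1 <= i < n)%N -> aff_act w i%:Z <= aff_act w i.+1%:Z) ->
  separating_wall m Reg (theta R n) m%:Z -> gap = (m * n).+1%:Z.
Proof.
move=> hn3 incr sw; have gt := separating_wall_gap sw.
apply/eqP; rewrite eq_le; apply/andP; split; last by lia.
rewrite leNgt; apply/negP => /(exists_middle hn3 incr)[i [l [hil lm h1 h2]]].
have ipn : (i.-1 < n)%N by lia.
pose c := Ordinal ipn.
have ec : c.+1 = i by rewrite /= prednK //; lia.
have lc : (lo < c)%N by rewrite /=; lia.
have ch : (c < hi)%N by rewrite /=; lia.
have p1 : l%:R <= p ord0 lo - p ord0 c.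
  by rewrite alcove_center_diff ec elo pmulrn int_le_div.
have p2 : (m - l)%:R <= p ord0 c - p ord0 hi.
  by rewrite alcove_center_diff ec ehi prednK // pmulrn int_le_div.
have cl1 := closure_ge (fun v => shi_region_ge lc lm p1 (v := v)).
have cl2 := closure_ge (fun v => shi_region_ge ch (leq_subr l m) p2 (v := v)).
have eth := theta_alpha R elo ehi.
(* On H_{theta,m} the lower bounds l and m - l add up to the value of theta, so both are
   equalities. *)
have face v : (closure Reg `&` hyperplane (theta R n) m%:Z) v ->
    v ord0 lo - v ord0 c = l%:R.
  move=> [cv [_]]; rewrite eth dot_alpha -pmulrn => ev.
  by have := cl1 v cv; have := cl2 v cv; rewrite natrB //; lra.
case: sw => [[_ [_ hull]] _].
(* This point of H_{theta,m} has value l + 1 on e_1 - e_i, not l. *)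
have [v Vv ev] := exists_V (fun j => if j == lo then m%:R else
  if j == c then m%:R - l%:R - 1 else 0 : R) n1.
have : hyperplane (theta R n) m%:Z v.
  split=> //; rewrite eth dot_alpha ev eqxx -pmulrn.
  rewrite (_ : hi == lo = false); last by apply/negP => /eqP/(congr1 val) /=; lia.
  rewrite (_ : hi == c = false) ?subr0 //.
  by apply/negP => /eqP/(congr1 val) /=; lia.
rewrite -hull => /(affine_hull_root face); rewrite ev !eqxx.
rewrite (_ : c == lo = false); first by lra.
by apply/negP => /eqP/(congr1 val) /=; lia.
Qed.

End Wall.

(* For n = 2 the region beyond H_{theta,m} contains infinitely many alcoves, so
   here the minimality of the alcove is needed. *)
Lemma separating_wall_gap_eq2 (R : realType) (m : nat) (Reg A : set 'rV[R]_2)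
    (w : seq 'I_2) :
  shi_region m Reg -> minimal_alcove Reg A ->
  A (alcove_center R 2 (aff_act w)) ->
  (m * 2)%N%:Z < aff_act w 2%:Z - aff_act w 1 ->
  aff_act w 2%:Z - aff_act w 1 = (m * 2).+1%:Z.
Proof.
move=> shiReg [alA subA minA] Ap gt.
set p := alcove_center R 2 (aff_act w) in Ap.
have Rp := subA _ Ap.
have pE : p ord0 ord0 - p ord0 ord_max = (aff_act w 2%:Z - aff_act w 1)%:~R / 2%:R.
  by rewrite alcove_center_diff.
have roots (x : 'rV[R]_2) : pos_roots x -> x = theta R 2.
  move/pos_rootsP => [a [b [ab ->]]]; have b2 := ltn_ord b.
  have ea : a = 0%N :> nat by lia.
  have eb : b = 1%N :> nat by lia.
  by rewrite (theta_alpha R ea eb).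
have eth : theta R 2 = alpha R 2 (@ord0 1).+1 (@ord_max 1) by [].
have pth : pos_roots (theta R 2).
  by rewrite eth; apply/pos_rootsP; exists ord0, ord_max.
apply/eqP; rewrite eq_le; apply/andP; split; last by lia.
rewrite leNgt; apply/negP => gt2.
(* The gap is odd, so exceeding 2 m + 1 puts it above 2 (m + 1): A lies beyond H_{theta,m+1}. *)
have nd : ~~ (2 %| aff_act w 2%:Z - aff_act w 1)%Z.
  exact: (@aff_act_ndvd 2 w ord0 ord_max).
have gt3 : (m.+1)%:Z * 2 < aff_act w 2%:Z - aff_act w 1 by lia.
have pgt : m.+1%:R < p ord0 ord0 - p ord0 ord_max.
  rewrite pE ltr_pdivlMr // pmulrn (pmulrn 1 2) -rmorphM /= ltr_int; lia.
(* b lies halfway between H_{theta,m} and H_{theta,m+1}; its alcove [B] is the competitor that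
   refutes the minimality of A. *)
have [b Vb bE] := @exists_V R 2 (fun j => if j == ord0 then m%:R + 1 / 2 else 0) isT.
have {}bE : b ord0 ord0 - b ord0 ord_max = m%:R + 1 / 2 by rewrite bE /= subr0.
have Rb : Reg b.
  apply: (shi_region_mem shiReg Rp) => // a c k ac hk.
  have -> : a = ord0 by apply/val_inj => /=; have := ltn_ord c; lia.
  have -> : c = ord_max by apply/val_inj => /=; have := ltn_ord c; lia.
  have km : k%:~R <= m%:R :> R by rewrite pmulrn ler_int; lia.
  rewrite bE; split=> h; first by lra.
  by move: pgt; rewrite -natr1; lra.
pose B := connected_component (complement (@affine_arrangement R 2)) b.
have cb : complement (@affine_arrangement R 2) b.
  split=> // -[_ [x [k [/roots -> ->]]] [_]]; rewrite eth dot_alpha bE => e.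
  have : (m%:Z * 2 + 1)%:~R = (k * 2)%:~R :> R.
    by rewrite rmorphD !rmorphM /= -e -pmulrn; lra.
  by move/intr_inj; lia.
have Bb : B b by exact: connected_component_refl.
have subB : B `<=` Reg.
  case: shiReg Rb => x _ -> cxb; rewrite (same_connected_component cxb).
  apply: connected_component_max => //; last exact: component_connected.
  apply: (subset_trans (@connected_component_sub _ _ _)) => v [Vv nv].
  split=> // -[H [x' [k [hx _ ->]]] Hv]; apply: nv.
  by exists (hyperplane x' k) => //; exists x', k.
have alB : alcove B by exists b.
have hc := alcove_center_fundamental R (leqnn 2).
have cE : alcove_center R 2 id ord0 ord0 - alcove_center R 2 id ord0 ord_max = 1 / 2.
  by rewrite alcove_center_diff.
(* With this shift the indices below N are the levels 1, ..., N: at least m + 1 hyperplanes separate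
   A from A_0, at most m separate B from it. *)
pose h (k : nat) := hyperplane (theta R 2) k.+1%:Z.
have hinj : injective h.
  move=> k l e.
  have [v Vv vE] := @exists_V R 2 (fun j => if j == ord0 then k.+1%:R else 0) isT.
  have : h k v by split=> //; rewrite eth dot_alpha vE /= subr0 -pmulrn.
  rewrite e => -[_]; rewrite eth dot_alpha vE /= subr0 -pmulrn => /eqP.
  by rewrite eqr_nat => /eqP[].
have cA : (`I_m.+1 #<= separating_hyperplanes A (@fundamental_alcove R 2))%card.
  rewrite -(card_le_eql (inj_card_eq (f := h) (in2W hinj))).
  apply: subset_card_le => _ [k /= km <-]; exists (theta R 2), k.+1%:Z; split=> //.
  left; split=> v hv; last first.
    have [[Vv _] hv1] := fundamental_alcove_sub hv; split=> //.
    by apply: (le_trans hv1); rewrite -pmulrn ler1n.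
  split; first exact: (shi_region_V shiReg (subA _ hv)).
  have kp : k.+1%:~R < p ord0 ord0 - p ord0 ord_max.
    by apply: le_lt_trans pgt; rewrite -pmulrn ler_nat.
  move: hv Ap; case: alA => x _ -> cv cp.
  rewrite eth dot_alpha ltW // -(@component_side R 2 (@affine_arrangement R 2)
    (connected_component (complement (@affine_arrangement R 2)) x) _ _ _ p v) //.
  - exact: component_connected.
  - exact: connected_component_sub.
  - by exists (theta R 2), k.+1%:Z.
have cB : (separating_hyperplanes B (@fundamental_alcove R 2) #<= `I_m)%card.
  apply: (card_le_trans _ (card_image_le h `I_m)).
  apply: subset_card_le => _ [x [k [/roots -> ->]]] [] [h1 h2].
    have [_] := h1 _ Bb; have [_] := h2 _ hc; rewrite eth !dot_alpha bE cE => k1 k2.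
    have k0 : (0 : int) < k.
      by rewrite -(ltr_int R); lra.
    have km : k <= m%:Z.
      rewrite leNgt; apply/negP => mk.
      have : (m%:Z + 1)%:~R <= k%:~R :> R by rewrite ler_int; lia.
      by rewrite rmorphD /= -pmulrn; lra.
    exists `|k|%N.-1; first by rewrite /=; lia.
    by rewrite /h; congr hyperplane; lia.
  (* In the reversed orientation B would force k > m and A_0 would force k <= 0. *)
  have [_] := h1 _ Bb; have [_] := h2 _ hc; rewrite eth !dot_alpha bE cE => k1 k2.
  exfalso; have km : m%:Z < k.
    by rewrite -(ltr_int R) -pmulrn; lra.
  have k0 : k <= 0.
    rewrite leNgt; apply/negP => mk.
    have : 1 <= k%:~R :> R by rewrite -[1]/(1%:~R) ler_int; lia.
    by lra.
  by lia.
have := card_le_trans cA (card_le_trans (minA B alB subB) cB).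
by rewrite card_le_II ltnn.
Qed.

Theorem theorem3p5 (R : realType) (n m : nat) (hn : (2 <= n)%N) (hm : (1 <= m)%N)
  (Reg A : set 'rV[R]_n) (la : seq nat) :
  shi_region m Reg -> dominant Reg -> minimal_alcove Reg A ->
  is_core n la -> Phi la A ->
  (separating_wall m Reg (theta R n) m%:Z
   <-> hook_length la 0 0 = (n * (m - 1) + 1)%N).
Proof.
move=> shiReg domReg minA _ [w [_ -> eA]].
have Ap : A (alcove_center R n (aff_act w)).
  rewrite eA; exists (alcove_center R n id); first exact: alcove_center_fundamental.
  exact: word_act_center.
have Rp : Reg (alcove_center R n (aff_act w)) by case: minA => _ + _; apply.
(* The i-th simple root equals (W(i + 1) - W(i)) / n at the centre, and dominance makes it
   nonnegative. *)
have incr i : (1 <= i < n)%N -> aff_act w i%:Z <= aff_act w i.+1%:Z.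
  move=> hi; have [_ /(_ i)] := domReg _ Rp.
  have hi2 : (1 <= i <= n.-1)%N by lia.
  have [a [b [ea eb ->]]] := simple_rootE (alcove_center R n (aff_act w)) hi2.
  move/(_ hi2); rewrite alcove_center_diff -[0]/(0%:~R) int_le_div; last by lia.
  by rewrite ea eb mul0r subr_ge0.
rewrite core_hook_aff_act //.
have h0 : (0 < n)%N by lia.
have hl : (n.-1 < n)%N by lia.
pose lo := Ordinal h0; pose hi := Ordinal hl.
split=> [sw|]; last first.
  exact: (theta_separating_wall hn hm shiReg (lo := lo) (hi := hi)).
case: (ltnP 2 n) => hn3.
  exact: (separating_wall_gap_eq hn hm shiReg (lo := lo) (hi := hi) _ _ Rp).
have gt := separating_wall_gap hn hm (lo := lo) (hi := hi) erefl erefl Rp sw.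
have e2 : n = 2%N by lia.
subst n; exact: (separating_wall_gap_eq2 shiReg minA Ap gt).
Qed.
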